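(* Let $p$ and $q$ be functions on $X$ and $Y$ such that $\log p\in L^\infty(X)$ and $\log q\in L^\infty(Y)$, and define $F_1=\lambda_1\mathrm{KL}(\cdot|p)$ and $F_2=\lambda_2\mathrm{KL}(\cdot|q)$ for some $\lambda_1,\lambda_2>0$. Assume that the kernel $K$ is bounded below by a positive real number. If $(a^{(\ell)},b^{(\ell)})$ are the scaling iterates $$a^{(\ell+1)}=\frac{\mathrm{prox}^{\mathrm{KL}}_{F_1/\epsilon}(\mathcal{K} b^{(\ell)})}{\mathcal{K} b^{(\ell)}},\qquad b^{(\ell+1)}=\frac{\mathrm{prox}^{\mathrm{KL}}_{F_2/\epsilon}(\mathcal{K}^{T} a^{(\ell+1)})}{\mathcal{K}^{T} a^{(\ell+1)}},\qquad \ell=0,1,2,\dots$$ initialized with $b^{(0)}=1$, then $(x,y)\mapsto a^{(\ell)}(x)K(x,y)b^{(\ell)}(y)$ converges at a linear rate, for the Thompson metric, to a solution of $$\min_{r\in L^1(X\times Y)} F_1(P^X_\# r)+F_2(P^Y_\# r)+\epsilon\,\mathrm{KL}(r|K).$$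
   Context: Setting: $(X,dx)$ and $(Y,dy)$ are probability spaces, $X\times Y$ carries the product measure $dx\,dy$, $\epsilon>0$, and $K\in L^\infty_+(X\times Y)$ (nonnegative, essentially bounded). $P^X_\# r(x)=\int_Y r(x,y)\,dy$ and $P^Y_\# r(y)=\int_X r(x,y)\,dx$. $(\mathcal{K}b)(x)=\int_Y K(x,y)b(y)\,dy$ and $(\mathcal{K}^{T}a)(y)=\int_X K(x,y)a(x)\,dx$ for nonnegative measurable $a,b$. For measurable real functions $r,s$ on a measured space $(T,dt)$, $\mathrm{KL}(r|s)=\int_T[\log(r/s)r-r+s]\,dt$ (with $0\log(0/0)=0$) if $r,s\ge0$ a.e. and ($s=0\Rightarrow r=0$) a.e., and $+\infty$ otherwise. $\mathrm{prox}^{\mathrm{KL}}_{F_1/\epsilon}(z)=\operatorname*{argmin}_{s}F_1(s)+\epsilon\,\mathrm{KL}(s|z)$ over measurable $s:X\to\mathbb{R}$, and similarly for $F_2$ on $Y$. Thompson metric: for $r,s\in L^\infty_+(T)$ (nonnegative elements of $L^\infty(T)$), let $M(r/s)=\inf\{\alpha\ge0: r\le\alpha s\ \text{a.e.}\}$ (or $\infty$ if that set is empty) and $d(r,s)=\max\{\log M(r/s),\log M(s/r)\}$. Here it is used on $T=X\times Y$. A sequence $r^{(\ell)}$ converges to $r$ at a linear rate for $d$ if there exist $C\ge0$ and $\rho\in[0,1)$ with $d(r^{(\ell)},r)\le C\rho^\ell$ for all $\ell\ge1$. *)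

(* Defs.v *)
From mathcomp Require Export all_boot all_order all_algebra.
From mathcomp Require Export all_classical all_reals all_analysis.

Set Implicit Arguments.
Unset Strict Implicit.
Unset Printing Implicit Defensive.

Export Order.TTheory GRing.Theory Num.Theory.
Export numFieldNormedType.Exports.

Local Open Scope classical_set_scope.
Local Open Scope ring_scope.

(* The space of nonnegative elements of L^oo(T); elements of Lebesgue spaces
   are handled through measurable representatives. *)
Definition Linfty_nonneg (R : realType) (d : measure_display)
    (T : measurableType d) (mu : {measure set T -> \bar R}) : set (T -> R) :=
  [set r | r \in Lfun mu +oo%E /\ \forall t \ae mu, 0 <= r t].

(* log f \in L^oo(T). Since [ln] is 0 on nonpositive reals, positivity of f
   has to be required for [ln \o f] to be the logarithm of f. *)
Definition log_Linfty (R : realType) (d : measure_display)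
    (T : measurableType d) (mu : {measure set T -> \bar R}) (f : T -> R) : Prop :=
  [/\ measurable_fun setT f, (\forall t \ae mu, 0 < f t) &
      (fun t => ln (f t)) \in Lfun mu +oo%E].

(* KL(r|s). In the first branch, where s t = 0 we have r t = 0, so the
   conventions on x / 0 and ln 0 play no role: the integrand is 0 there. *)
Definition KL (R : realType) (d : measure_display) (T : measurableType d)
    (mu : {measure set T -> \bar R}) (r s : T -> R) : \bar R :=
  if `[< [/\ (\forall t \ae mu, 0 <= r t), (\forall t \ae mu, 0 <= s t) &
             \forall t \ae mu, s t = 0 -> r t = 0] >]
  then (\int[mu]_t (ln (r t / s t) * r t - r t + s t)%:E)%E
  else +oo%E.

Definition argmin (R : realType) (S : Type) (D : set S) (J : S -> \bar R) :
    set S :=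
  [set s | D s /\ forall s', D s' -> (J s <= J s')%E].

(* prox^KL_{F/eps}(z), as the set of all minimizers. *)
Definition proxKL (R : realType) (d : measure_display) (T : measurableType d)
    (mu : {measure set T -> \bar R}) (F : (T -> R) -> \bar R) (eps : R)
    (z : T -> R) : set (T -> R) :=
  argmin [set s | measurable_fun setT s]
         (fun s => F s + eps%:E * KL mu s z)%E.

(* Thompson metric; an empty infimum is +oo, and [lne] is the extended
   logarithm, with lne 0 = -oo and lne +oo = +oo. *)
Definition Thompson_M (R : realType) (d : measure_display)
    (T : measurableType d) (mu : {measure set T -> \bar R}) (r s : T -> R) :
    \bar R :=
  ereal_inf [set alpha%:E | alpha in
    [set alpha : R | 0 <= alpha /\ \forall t \ae mu, r t <= alpha * s t]].

Definition Thompson_dist (R : realType) (d : measure_display)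
    (T : measurableType d) (mu : {measure set T -> \bar R}) (r s : T -> R) :
    \bar R :=
  maxe (lne (Thompson_M mu r s)) (lne (Thompson_M mu s r)).

Definition Thompson_linear_cvg (R : realType) (d : measure_display)
    (T : measurableType d) (mu : {measure set T -> \bar R})
    (u : nat -> T -> R) (r : T -> R) : Prop :=
  [/\ (forall l, (1 <= l)%N -> Linfty_nonneg mu (u l)),
      Linfty_nonneg mu r &
      exists C rho : R, [/\ 0 <= C, 0 <= rho, rho < 1 &
        forall l, (1 <= l)%N ->
          (Thompson_dist mu (u l) r <= (C * rho ^+ l)%:E)%E]].

Definition marginalX (R : realType) (d1 d2 : measure_display)
    (X : measurableType d1) (Y : measurableType d2)
    (nu : {measure set Y -> \bar R}) (r : X * Y -> R) : X -> R :=
  fun x => (\int[nu]_(y in setT) r (x, y))%R.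

Definition marginalY (R : realType) (d1 d2 : measure_display)
    (X : measurableType d1) (Y : measurableType d2)
    (mu : {measure set X -> \bar R}) (r : X * Y -> R) : Y -> R :=
  fun y => (\int[mu]_(x in setT) r (x, y))%R.

Definition kernel_app (R : realType) (d1 d2 : measure_display)
    (X : measurableType d1) (Y : measurableType d2)
    (nu : {measure set Y -> \bar R}) (K : X * Y -> R) (b : Y -> R) : X -> R :=
  fun x => (\int[nu]_(y in setT) (K (x, y) * b y))%R.

Definition kernel_tapp (R : realType) (d1 d2 : measure_display)
    (X : measurableType d1) (Y : measurableType d2)
    (mu : {measure set X -> \bar R}) (K : X * Y -> R) (a : X -> R) : Y -> R :=
  fun y => (\int[mu]_(x in setT) (K (x, y) * a x))%R.

(* The recursion holds between equivalence classes of functions, hence the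
   almost everywhere equalities; a 0 is not constrained. *)
Definition scaling_iterates (R : realType) (d1 d2 : measure_display)
    (X : measurableType d1) (Y : measurableType d2)
    (mu : {measure set X -> \bar R}) (nu : {measure set Y -> \bar R})
    (K : X * Y -> R) (F1 : (X -> R) -> \bar R) (F2 : (Y -> R) -> \bar R)
    (eps : R) (a : nat -> X -> R) (b : nat -> Y -> R) : Prop :=
  [/\ (forall l, measurable_fun setT (a l.+1)) /\
      (forall l, measurable_fun setT (b l)),
      (\forall y \ae nu, b 0%N y = 1),
      (forall l, exists2 s, proxKL mu F1 eps (kernel_app nu K (b l)) s &
        \forall x \ae mu, a l.+1 x = s x / kernel_app nu K (b l) x) &
      (forall l, exists2 s, proxKL nu F2 eps (kernel_tapp mu K (a l.+1)) s &
        \forall y \ae nu, b l.+1 y = s y / kernel_tapp mu K (a l.+1) y)].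

(* Solutions of min_{r in L^1(X * Y)} F1(P^X r) + F2(P^Y r) + eps KL(r|K). *)
Definition scaling_solutions (R : realType) (d1 d2 : measure_display)
    (X : measurableType d1) (Y : measurableType d2)
    (mu : probability X R) (nu : probability Y R)
    (K : X * Y -> R) (F1 : (X -> R) -> \bar R) (F2 : (Y -> R) -> \bar R)
    (eps : R) : set (X * Y -> R) :=
  argmin [set r | r \in Lfun (mu \x nu)%E 1%E]
    (fun r => F1 (marginalX nu r) + F2 (marginalY mu r)
              + eps%:E * KL (mu \x nu)%E r K)%E.

(* Main.v *)
(** Completing the square for relative entropy, [l KL(s|p) + e KL(s|z)] is
    [(l + e) KL(s|m)] plus a constant, where [m] is the weighted geometric mean
    of [p] and [z]; so the proximal step is explicit and, with
    [theta_i = lambda_i / (lambda_i + eps)], the iterates are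
    [a = (p / K b)^theta_1], [b = (q / K^T a)^theta_2].
    In the variables [log a], [log b] each half step is Lipschitz for the sup
    norm with constant [theta_i], because [b |-> K b] is monotone and
    homogeneous; hence [log b] converges geometrically to a fixed point.
    At the fixed point, bounding each of the three entropies from below by its
    tangent at the candidate [a K b] makes all terms depending on the competitor
    cancel, by Fubini, which shows that [a K b] is optimal.
    Essential bounds are first turned into pointwise ones by changing [K], [p]
    and [q] on null sets. *)
From mathcomp Require Import ring lra measurable_realfun ess_sup_inf.
From mathcomp Require Import measurable_fun_approximation.
Require Import Defs.

Set Implicit Arguments.
Unset Strict Implicit.
Unset Printing Implicit Defensive.

Local Open Scope classical_set_scope.
Local Open Scope ring_scope.

(** * Relative entropy density *)

Section RelativeEntropyDensity.
Context {R : realType}.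
Implicit Types u v w : R.

(** Written exactly as the integrand of [KL], so that the two are convertible. *)
Definition kl u v : R := ln (u / v) * u - u + v.

Lemma klE u v : 0 <= u -> 0 < v -> kl u v = (ln u - ln v) * u - u + v.
Proof.
rewrite /kl le_eqVlt => /predU1P[<-|u0] v0; first by rewrite !mulr0.
by rewrite ln_div.
Qed.

(** For [u > 0], put [d = ln v - ln u], which is nonzero. The strict inequality [1 + d < expR d],
    multiplied by [u], reads [(1 + d) * u < v], and this is the claim. *)
Lemma kl_gt0 u v : 0 <= u -> 0 < v -> u != v -> 0 < kl u v.
Proof.
rewrite le_eqVlt => /predU1P[<-|u0] v0 uv; first by rewrite /kl mulr0 subr0 add0r.
have d0 : ln v - ln u != 0.
  by rewrite subr_eq0; apply: contra uv => /eqP/ln_inj-> //; rewrite posrE.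
have := expR_gt1Dx d0; rewrite expRD expRN !lnK ?posrE//.
rewrite -(ltr_pM2r u0) divfK ?gt_eqF// klE ?ltW//.
rewrite -subr_gt0 => h; rewrite (_ : _ + v = v - (1 + (ln v - ln u)) * u)//; ring.
Qed.

Lemma kl_ge0 u v : 0 <= u -> 0 < v -> 0 <= kl u v.
Proof.
move=> u0 v0; have [->|uv] := eqVneq u v; last by rewrite ltW ?kl_gt0.
by rewrite (klE (ltW v0) v0) subrr mul0r sub0r addNr.
Qed.

Lemma kl_eq0 u v : 0 <= u -> 0 < v -> kl u v = 0 -> u = v.
Proof.
move=> u0 v0 kl0; apply/eqP; apply/negPn/negP => /(kl_gt0 u0 v0).
by rewrite kl0 ltxx.
Qed.

(** The left side is the tangent at [u = w] of the convex function [kl ^~ v]; the gap between the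
    two sides is exactly [kl u w]. *)
Lemma kl_tangent u v w : 0 <= u -> 0 < v -> 0 < w ->
  u * (ln w - ln v) - w + v <= kl u v.
Proof.
move=> u0 v0 w0; have := kl_ge0 u0 w0; rewrite !klE//.
rewrite -subr_ge0 => h; rewrite -subr_ge0; apply: le_trans h _.
rewrite le_eqVlt; apply/orP; left; apply/eqP; ring.
Qed.

End RelativeEntropyDensity.

Lemma measurable_funV d (T : measurableType d) (R : realType) (f : T -> R) :
  measurable_fun setT f -> measurable_fun setT (fun t => (f t)^-1).
Proof.
(* Squaring makes the base of the real power nonnegative; where [f t = 0] both sides are 0. *)
move=> mf; rewrite (_ : (fun _ => _) = fun t => f t * (f t ^+ 2) `^ (-1)).
  apply: measurable_funM => //.
  by apply: measurableT_comp (measurable_powR (-1)) _; exact: measurable_funX.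
apply/funext => t; rewrite powR_inv1 ?sqr_ge0// expr2.
by have [->|f0] := eqVneq (f t) 0; rewrite ?invr0 ?mul0r// invfM mulVKf.
Qed.

Lemma measurable_kl d (T : measurableType d) (R : realType) (r s : T -> R) :
  measurable_fun setT r -> measurable_fun setT s ->
  measurable_fun setT (fun t => kl (r t) (s t)).
Proof.
move=> mr ms; rewrite /kl; apply: measurable_funD => //.
apply: measurable_funB => //; apply: measurable_funM => //.
apply: measurableT_comp => //; apply: measurable_funM => //.
exact: measurable_funV.
Qed.

(** * Bounded measurable functions *)

Section BoundedMeasurable.
Context d (T : measurableType d) (R : realType).
Implicit Types f g : T -> R.

(** The bound holds at every point rather than almost everywhere, so that the fixed point iteration
    can be run pointwise, without null sets. *)
Definition bounded_measurable f :=
  measurable_fun setT f /\ exists B, forall t, `|f t| <= B.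

Lemma bounded_measurable_cst (c : R) : bounded_measurable (fun=> c).
Proof. by split; [exact: measurable_cst | exists `|c|]. Qed.

Lemma bounded_measurableD f g : bounded_measurable f -> bounded_measurable g ->
  bounded_measurable (fun t => f t + g t).
Proof.
move=> [mf [B fB]] [mg [C gC]]; split; first exact: measurable_funD.
by exists (B + C) => t; rewrite (le_trans (ler_normD _ _))// lerD.
Qed.

Lemma bounded_measurableM f g : bounded_measurable f -> bounded_measurable g ->
  bounded_measurable (fun t => f t * g t).
Proof.
move=> [mf [B fB]] [mg [C gC]]; split; first exact: measurable_funM.
by exists (B * C) => t; rewrite normrM ler_pM.
Qed.

Lemma bounded_measurableZ (c : R) f : bounded_measurable f ->
  bounded_measurable (fun t => c * f t).
Proof. by move=> bf; apply: bounded_measurableM => //; exact: bounded_measurable_cst. Qed.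

Lemma bounded_measurableN f : bounded_measurable f ->
  bounded_measurable (fun t => - f t).
Proof.
move=> [mf [B fB]]; split; first exact: measurableT_comp.
by exists B => t; rewrite normrN.
Qed.

Lemma bounded_measurableB f g : bounded_measurable f -> bounded_measurable g ->
  bounded_measurable (fun t => f t - g t).
Proof. by move=> bf /bounded_measurableN; exact: bounded_measurableD. Qed.

Lemma bounded_measurable_expR f : bounded_measurable f ->
  bounded_measurable (fun t => expR (f t)).
Proof.
move=> [mf [B fB]]; split; first exact: measurableT_comp.
exists (expR B) => t; rewrite gtr0_norm ?expR_gt0// ler_expR.
by rewrite (le_trans (ler_norm _)).
Qed.

Lemma bounded_measurable_ln_expR f : bounded_measurable f ->
  bounded_measurable (fun t => ln (expR (f t))).
Proof. by rewrite (_ : (fun _ => _) = f)//; apply/funext => t; rewrite expRK. Qed.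

Lemma bounded_measurable_ln f (k M : R) : 0 < k -> measurable_fun setT f ->
  (forall t, k <= f t <= M) -> bounded_measurable (fun t => ln (f t)).
Proof.
move=> k0 mf fkM; split; first exact: measurableT_comp.
exists (`|ln k| + `|ln M|) => t; have /andP[kf fM] := fkM t.
have f0 := lt_le_trans k0 kf; have M0 := lt_le_trans f0 fM.
have : ln k <= ln (f t) by rewrite ler_ln ?posrE.
have : ln (f t) <= ln M by rewrite ler_ln ?posrE.
have := ler_norm (ln M); have := ler_norm (- ln k).
rewrite normrN ler_norml => h1 h2 h3 h4.
have := normr_ge0 (ln M); have := normr_ge0 (ln k).
by move=> h5 h6; lra.
Qed.

Lemma bounded_measurable_integrable (mu : {measure set T -> \bar R}) f :
  (mu setT < +oo)%E -> bounded_measurable f ->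
  mu.-integrable setT (EFin \o f).
Proof.
move=> fmu [mf [B fB]]; apply: measurable_bounded_integrable => //.
exists B; split; first exact: num_real.
by move=> M BM t _ /=; rewrite (le_trans (fB t))// ltW.
Qed.

Lemma integrable_bounded_measurableM (mu : {measure set T -> \bar R}) f g :
  mu.-integrable setT (EFin \o f) -> bounded_measurable g ->
  mu.-integrable setT (EFin \o (fun t => f t * g t)).
Proof.
move=> intf [mg [B gB]].
have B0 : 0 <= B by rewrite (le_trans (normr_ge0 (g point))).
apply: (@le_integrable _ _ _ _ _ measurableT _ (fun t => B%:E * (f t)%:E)%E).
- apply/measurable_EFinP; apply: measurable_funM => //.
  by apply/measurable_EFinP; exact: measurable_int intf.
- move=> t _ /=; rewrite lee_fin !normrM mulrC ler_wpM2r//.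
  by rewrite (ger0_norm B0).
- exact: integrableZl.
Qed.

End BoundedMeasurable.

Lemma probability_setT_lty d (T : measurableType d) (R : realType)
    (P : probability T R) : (P setT < +oo)%E.
Proof. by rewrite [ltLHS](_ : _ = 1%E) ?ltry//; exact: probability_setT. Qed.

(** * The relative entropy as a functional *)

Section RelativeEntropy.
Context d (T : measurableType d) (R : realType).
Variable mu : {measure set T -> \bar R}.
Implicit Types r s g : T -> R.

(** Covers a nonnegative [f] of infinite integral, which is the situation of an entropy not yet
    known to be finite. *)
Lemma ae_le_integral_ge0 (f g : T -> R) :
  mu.-integrable setT (EFin \o g) -> measurable_fun setT f ->
  (\forall t \ae mu, 0 <= f t) -> (\forall t \ae mu, g t <= f t) ->
  (\int[mu]_t (g t)%:E <= \int[mu]_t (f t)%:E)%E.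
Proof.
move=> intg mf f0 gf.
have mg : measurable_fun setT g.
  by apply/measurable_EFinP; exact: measurable_int intg.
(* This equals [f] almost everywhere, and it is nonnegative and above [g] at every point. *)
pose f' t := Num.max (Num.max (f t) (g t)) 0.
have mf' : measurable_fun setT f'.
  by apply: measurable_maxr => //; exact: measurable_maxr.
rewrite (@ae_eq_integral _ _ _ mu _ (EFin \o f') (EFin \o f))//; last 3 first.
- exact/measurable_EFinP.
- exact/measurable_EFinP.
- near=> t => _ /=; rewrite /f'; congr EFin.
  by rewrite max_l ?max_l//; near: t.
have [intf'|] := boolP (mu.-integrable setT (EFin \o f')).
  apply: le_integral => // t _.
  by rewrite lee_fin /f' !le_max lexx orbT.
(* A nonnegative measurable function that is not integrable has integral [+oo]. *)
move=> /negP nint; rewrite (_ : (\int[mu]_t (EFin \o f') t)%E = +oo%E) ?leey//.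
apply/eqP; rewrite -leye_eq leNgt; apply/negP => finf'; apply: nint.
apply/integrableP; split; first exact/measurable_EFinP.
under eq_integral do rewrite gee0_abs ?lee_fin /= ?le_max ?lexx ?orbT//.
exact: finf'.
Unshelve. all: by end_near. Qed.

(** In the integral branch of [KL] the pointwise minorant is integrated; in the other branch the
    value is [+oo]. *)
Lemma KL_ge r s g : measurable_fun setT r -> measurable_fun setT s ->
  mu.-integrable setT (EFin \o g) -> (\forall t \ae mu, 0 < s t) ->
  (forall t, 0 <= r t -> 0 < s t -> g t <= kl (r t) (s t)) ->
  (\int[mu]_t (g t)%:E <= KL mu r s)%E.
Proof.
move=> mr ms intg s0 gkl; rewrite /KL; case: asboolP => [[r0 _ _]|_]; last first.
  by rewrite leey.
apply: (@ae_le_integral_ge0 (fun t => kl (r t) (s t))) => //.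
- exact: measurable_kl.
- by near=> t; apply: kl_ge0; near: t.
- by near=> t; apply: gkl; near: t.
Unshelve. all: by end_near. Qed.

Lemma KL_ge0 r s : measurable_fun setT r -> measurable_fun setT s ->
  (\forall t \ae mu, 0 < s t) -> (0 <= KL mu r s)%E.
Proof.
move=> mr ms s0; rewrite -(integral0 mu setT); apply: KL_ge => //.
  exact: integrable0.
by move=> t; exact: kl_ge0.
Qed.

Lemma KLE r s : (forall t, 0 <= r t) -> (forall t, 0 < s t) ->
  KL mu r s = (\int[mu]_t (kl (r t) (s t))%:E)%E.
Proof.
move=> r0 s0; rewrite /KL asboolT//; split.
- exact: aeW.
- by apply: aeW => t; exact: ltW.
- by apply: aeW => t st0; have := s0 t; rewrite st0 ltxx.
Qed.

Lemma KL_lty r s : (KL mu r s < +oo)%E ->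
  (\forall t \ae mu, 0 <= r t) /\ KL mu r s = (\int[mu]_t (kl (r t) (s t))%:E)%E.
Proof. by rewrite /KL; case: asboolP => [[]|_]//; rewrite ltxx. Qed.

(** Allows [p], [q] and [K] to be replaced by versions with pointwise bounds. *)
Lemma eq_KLr r s s' : measurable_fun setT r -> measurable_fun setT s ->
  measurable_fun setT s' -> (\forall t \ae mu, s t = s' t) ->
  KL mu r s = KL mu r s'.
Proof.
move=> mr ms ms' ss'; rewrite /KL.
rewrite (@ae_eq_integral _ _ _ mu setT
  (fun t => (kl (r t) (s' t))%:E) (fun t => (kl (r t) (s t))%:E))//;
  [|exact/measurable_EFinP/measurable_kl|exact/measurable_EFinP/measurable_kl|]; last first.
  by apply: filterS ss' => t /= -> _.
congr (if _ then _ else _); apply: asbool_equiv_eq; split=> -[r0 s0 sr]; split => //.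
- by near=> t; rewrite -(near ss' t)//; near: t.
- by near=> t; rewrite -(near ss' t)//; near: t.
- by near=> t; rewrite (near ss' t)//; near: t.
- by near=> t; rewrite (near ss' t)//; near: t.
Unshelve. all: by end_near. Qed.

Lemma bounded_measurable_kl r s :
  bounded_measurable r -> (forall t, 0 <= r t) ->
  bounded_measurable (fun t => ln (r t)) ->
  bounded_measurable s -> (forall t, 0 < s t) ->
  bounded_measurable (fun t => ln (s t)) ->
  bounded_measurable (fun t => kl (r t) (s t)).
Proof.
move=> br r0 blr bs s0 bls.
rewrite (_ : (fun _ => _) = fun t => (ln (r t) - ln (s t)) * r t - r t + s t).
  apply: bounded_measurableD => //; apply: bounded_measurableB => //.
  by apply: bounded_measurableM => //; exact: bounded_measurableB.
by apply/funext => t; rewrite klE.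
Qed.

End RelativeEntropy.

(** * Proximal operator of the relative entropy *)

Section Proximal.
Context d (T : measurableType d) (R : realType).
Variable mu : {measure set T -> \bar R}.
Hypothesis mu_fin : (mu setT < +oo)%E.
Implicit Types f lp lz : T -> R.

Lemma EFin_Rintegral f : mu.-integrable setT (EFin \o f) ->
  (\int[mu]_t (f t)%:E)%E = ((\int[mu]_t f t)%R)%:E.
Proof. by move=> intf; rewrite fineK//; exact: integrable_fin_num. Qed.

Lemma ae_ge0_integrable f : measurable_fun setT f ->
  (\forall t \ae mu, 0 <= f t) -> (\int[mu]_t (f t)%:E < +oo)%E ->
  mu.-integrable setT (EFin \o f).
Proof.
move=> mf f0 foo; apply/integrableP; split; first exact/measurable_EFinP.
rewrite (@ae_eq_integral _ _ _ mu setT (EFin \o f) (fun t => `|(EFin \o f) t|)%E)//.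
- by apply: measurableT_comp => //; exact/measurable_EFinP.
- exact/measurable_EFinP.
- by apply: filterS f0 => t f0 _ /=; rewrite ger0_norm.
Qed.

(** The density is nonnegative almost everywhere, so finiteness of its integral is integrability.
    Integrals of sums can then be split. *)
Lemma KL_lty_integrable r lp : measurable_fun setT r -> bounded_measurable lp ->
  (KL mu r (expR \o lp) < +oo)%E ->
  [/\ \forall t \ae mu, 0 <= r t,
      mu.-integrable setT (EFin \o (fun t => kl (r t) (expR (lp t)))) &
      KL mu r (expR \o lp) = ((\int[mu]_t kl (r t) (expR (lp t)))%R)%:E].
Proof.
move=> mr [mlp _] /[dup] KLoo /KL_lty[r0 KLE].
have intkl : mu.-integrable setT (EFin \o (fun t => kl (r t) (expR (lp t)))).
  apply: ae_ge0_integrable; last by rewrite KLE in KLoo.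
    by apply: measurable_kl => //; exact: measurableT_comp.
  by apply: filterS r0 => t r0; rewrite kl_ge0 ?expR_gt0.
by split => //; rewrite KLE /= EFin_Rintegral.
Qed.

(** Completing the square: both sides carry [(l + e) * ln u * u], and [ln m] is chosen to match the
    terms linear in [u], so the last bracket does not depend on [u]. *)
Lemma kl_geometric_mean (l e : R) (x y u : R) : 0 < l -> 0 < e -> 0 <= u ->
  let m := expR (l / (l + e) * x + e / (l + e) * y) in
  l * kl u (expR x) + e * kl u (expR y) =
  (l + e) * kl u m + (l * expR x + e * expR y - (l + e) * m).
Proof.
move=> l0 e0 u0 m; have le0 : l + e != 0 by rewrite gt_eqF// addr_gt0.
rewrite !klE ?expR_gt0// /m !expRK; field.
exact: le0.
Qed.

(** Let [m = expR \o lm] be the geometric mean. By the completed square, the objective at [s]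
    exceeds its value at [m] by [(l + e)] times the integral of [kl s m]. Minimality of [s] makes
    this excess nonpositive, hence [s = m] almost everywhere. Only the uniqueness half is shown: the
    minimizer is given. *)
Lemma proxKL_KL (F : (T -> R) -> \bar R) (l e : R) lp lz (s z : T -> R) :
  0 < l -> 0 < e -> bounded_measurable lp -> bounded_measurable lz ->
  (forall r, measurable_fun setT r -> F r = (l%:E * KL mu r (expR \o lp))%E) ->
  measurable_fun setT z -> (\forall t \ae mu, z t = expR (lz t)) ->
  proxKL mu F e z s ->
  \forall t \ae mu, s t = expR (l / (l + e) * lp t + e / (l + e) * lz t).
Proof.
move=> l0 e0 blp blz FE mz zlz [/= ms smin].
set lm := fun t => l / (l + e) * lp t + e / (l + e) * lz t.
have blm : bounded_measurable lm.
  by apply: bounded_measurableD; apply: bounded_measurableZ.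
have bp := bounded_measurable_expR blp.
have bz := bounded_measurable_expR blz.
have bm := bounded_measurable_expR blm.
have KLz r : measurable_fun setT r -> KL mu r z = KL mu r (expR \o lz).
  by move=> mr; apply: eq_KLr => //; exact: bz.1.
(* The remainder of the completed square; its integral is the value of the objective at [m], since
   [kl m m = 0]. *)
pose c t := l * expR (lp t) + e * expR (lz t) - (l + e) * expR (lm t).
have bc : bounded_measurable c.
  by apply: bounded_measurableB; [apply: bounded_measurableD|];
    apply: bounded_measurableZ.
have bklm (f : T -> R) : bounded_measurable f ->
    bounded_measurable (fun t => kl (expR (lm t)) (expR (f t))).
  move=> bf; apply: bounded_measurable_kl.
  - by [].
  - by move=> t; exact: expR_ge0.
  - exact: bounded_measurable_ln_expR.
  - exact: bounded_measurable_expR.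
  - by move=> t; exact: expR_gt0.
  - exact: bounded_measurable_ln_expR.
have intb (f : T -> R) : bounded_measurable f -> mu.-integrable setT (EFin \o f).
  exact: bounded_measurable_integrable.
have KLm (f : T -> R) : bounded_measurable f ->
    KL mu (expR \o lm) (expR \o f) =
    ((\int[mu]_t kl (expR (lm t)) (expR (f t)))%R)%:E.
  move=> bf; rewrite KLE; last 2 first.
  - by move=> t; exact: expR_ge0.
  - by move=> t; exact: expR_gt0.
  by rewrite -EFin_Rintegral//; apply: intb; exact: bklm.
have Jm : (F (expR \o lm) + e%:E * KL mu (expR \o lm) z)%E =
    ((\int[mu]_t c t)%R)%:E.
  rewrite FE ?KLz; [|exact: bm.1|exact: bm.1].
  rewrite !KLm// -!EFinM -EFinD -!RintegralZl//; last 2 first.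
  - exact/intb/bklm.
  - exact/intb/bklm.
  rewrite -RintegralD//; last 2 first.
  - by apply: intb; apply: bounded_measurableZ; exact: bklm.
  - by apply: intb; apply: bounded_measurableZ; exact: bklm.
  congr EFin; apply: eq_Rintegral => t _.
  rewrite kl_geometric_mean ?expR_ge0// /c -/(lm t).
  rewrite klE ?expR_gt0 ?expR_ge0// subrr mul0r sub0r addNr mulr0 add0r.
  by [].
have := smin _ bm.1; rewrite Jm FE// KLz// => Js.
have KLp0 : (0 <= KL mu s (expR \o lp))%E.
  by apply: KL_ge0 => //; [exact: bp.1|apply: aeW => t; exact: expR_gt0].
have KLz0 : (0 <= KL mu s (expR \o lz))%E.
  by apply: KL_ge0 => //; [exact: bz.1|apply: aeW => t; exact: expR_gt0].
(* The objective at [s] is at most its finite value at [m], and both entropies are nonnegative, so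
   neither can be infinite. *)
have KLpoo : (KL mu s (expR \o lp) < +oo)%E.
  rewrite ltey; apply/eqP => KLpoo; move: Js; rewrite KLpoo gt0_muley ?lte_fin//.
  by rewrite addye ?leNgt ?ltry// gt_eqF// (lt_le_trans _ (mule_ge0 _ _))// lee_fin ltW.
have KLzoo : (KL mu s (expR \o lz) < +oo)%E.
  rewrite ltey; apply/eqP => KLzoo; move: Js; rewrite KLzoo gt0_muley ?lte_fin//.
  by rewrite addey ?leNgt ?ltry// gt_eqF// (lt_le_trans _ (mule_ge0 _ _))// lee_fin ltW.
have [s0 intp KLpE] := KL_lty_integrable ms blp KLpoo.
have [_ intz KLzE] := KL_lty_integrable ms blz KLzoo.
have intl : mu.-integrable setT (EFin \o (fun t => l * kl (s t) (expR (lp t)))).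
  exact: (integrableZl measurableT l intp).
have inte : mu.-integrable setT (EFin \o (fun t => e * kl (s t) (expR (lz t)))).
  exact: (integrableZl measurableT e intz).
move: Js; rewrite KLpE KLzE -!EFinM -EFinD lee_fin -!RintegralZl// -RintegralD//.
rewrite -subr_le0 -RintegralB//; last 2 first.
- exact: (integrableD measurableT intl inte).
- exact: intb.
(* [h] is the integrand of the objective at [s] minus that at [m]. It is nonnegative almost
   everywhere and has nonpositive integral, so it vanishes almost everywhere. *)
set h := (X in \int[mu]_(t in setT) X t) => h_le0.
have inth : mu.-integrable setT (EFin \o h).
  have := integrableB measurableT (integrableD measurableT intl inte) (intb _ bc).
  exact.
have hE t : 0 <= s t -> h t = (l + e) * kl (s t) (expR (lm t)).
  by move=> st; rewrite /h kl_geometric_mean// -/(lm t) addrK.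
have h_ge0 : \forall t \ae mu, 0 <= h t.
  apply: filterS s0 => t st; rewrite hE// mulr_ge0 ?kl_ge0 ?expR_gt0//.
  by rewrite addr_ge0 ?ltW.
have /(ae_eq_integral_abs _ measurableT) : (\int[mu]_t `|(EFin \o h) t| = 0)%E.
  rewrite (@ae_eq_integral _ _ _ mu setT (EFin \o h))//.
  - apply/eqP; rewrite eq_le EFin_Rintegral// lee_fin h_le0/=.
    rewrite -EFin_Rintegral// -(integral0 mu setT).
    apply: ae_le_integral_ge0 => //; first exact: integrable0.
    by apply/measurable_EFinP; exact: measurable_int inth.
  - by apply: measurableT_comp => //; exact: measurable_int inth.
  - exact: measurable_int inth.
  - by apply: filterS h_ge0 => t ht _ /=; rewrite ger0_norm.
move=> /(_ (measurable_int _ inth)); apply: filterS2 s0 => t st /(_ I)/= [].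
rewrite hE// => /eqP; rewrite mulf_eq0 gt_eqF ?addr_gt0//= => /eqP.
by move=> /kl_eq0 -> //; exact: expR_gt0.
Qed.

End Proximal.

(** * Marginals on a product space *)

Section ProductSpace.
Context d1 d2 (X : measurableType d1) (Y : measurableType d2) (R : realType).
Variables (mu : probability X R) (nu : probability Y R).

(** The product measure of a null set [N] is by definition the integral of [nu (xsection N x)],
    which must therefore vanish for almost every [x]. *)
Lemma ae_xsection (P : X * Y -> Prop) : (\forall z \ae (mu \x nu)%E, P z) ->
  \forall x \ae mu, \forall y \ae nu, P (x, y).
Proof.
move=> [N [mN N0 PN]].
have /(ae_eq_integral_abs mu measurableT) : (\int[mu]_x `|nu (xsection N x)| = 0)%E.
  by under eq_integral do rewrite gee0_abs//; exact: N0.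
move=> /(_ (measurable_fun_xsection nu mN)); apply: filterS => x /(_ I) /= Nx0.
exists (xsection N x); split => //; first exact: measurable_xsection.
by move=> y /= nP; rewrite /xsection/= inE; exact: PN.
Qed.

Lemma ae_ysection (P : X * Y -> Prop) : (\forall z \ae (mu \x nu)%E, P z) ->
  \forall y \ae nu, \forall x \ae mu, P (x, y).
Proof.
move=> [N [mN N0 PN]].
(* The product measure is built from sections at fixed [x]; uniqueness identifies it with the one
   built from sections at fixed [y]. *)
have N0' : (mu \x^ nu)%E N = 0%E.
  rewrite -N0; apply/esym; apply: (@product_measure_unique _ _ _ _ _ mu nu) => // A B mA mB.
  exact: product_measure2E.
have /(ae_eq_integral_abs nu measurableT) : (\int[nu]_y `|mu (ysection N y)| = 0)%E.
  by under eq_integral do rewrite gee0_abs//; exact: N0'.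
move=> /(_ (measurable_fun_ysection mu mN)); apply: filterS => y /(_ I) /= Ny0.
exists (ysection N y); split => //; first exact: measurable_ysection.
by move=> x /= nP; rewrite /ysection/= inE; exact: PN.
Qed.

Lemma ae_prod_fst (P : X -> Prop) : (\forall x \ae mu, P x) ->
  \forall z \ae (mu \x nu)%E, P z.1.
Proof.
move=> [N [mN N0 PN]]; exists (N `*` setT); split.
- exact: measurableX.
- by rewrite product_measure1E// [X in (X * _)%E](_ : _ = 0%E) ?mul0e.
- by move=> z /= nP; split => //; exact: PN.
Qed.

Lemma ae_prod_snd (P : Y -> Prop) : (\forall y \ae nu, P y) ->
  \forall z \ae (mu \x nu)%E, P z.2.
Proof.
move=> [N [mN N0 PN]]; exists (setT `*` N); split.
- exact: measurableX.
- by rewrite product_measure1E// [X in (_ * X)%E](_ : _ = 0%E) ?mule0.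
- by move=> z /= nP; split => //; exact: PN.
Qed.

Lemma product_measure_fin : ((mu \x nu)%E setT < +oo)%E.
Proof.
rewrite -setXTT product_measure1E// [X in (X * _)%E](_ : _ = 1%E);
  last exact: probability_setT.
by rewrite mul1e [ltLHS](_ : _ = 1%E) ?ltry//; exact: probability_setT.
Qed.

(** For merely measurable [r], Tonelli applies to the positive and negative parts separately, and
    [fine] is measurable. *)
Lemma measurable_marginalX (r : X * Y -> R) : measurable_fun setT r ->
  measurable_fun setT (marginalX nu r).
Proof.
move=> /measurable_EFinP mr; apply: (measurableT_comp (fine_measurable measurableT)).
rewrite (_ : (fun _ => _) = fun x =>
  \int[nu]_y (EFin \o r)^\+ (x, y) - \int[nu]_y (EFin \o r)^\- (x, y))%E.
  apply: emeasurable_funB.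
    by apply: measurable_fun_fubini_tonelli_F => //; exact: measurable_funepos.
  by apply: measurable_fun_fubini_tonelli_F => //; exact: measurable_funeneg.
by apply/funext => t; rewrite [LHS]integralE; congr (_ - _)%E;
  apply: eq_integral => u _; rewrite ?funeposE ?funenegE.
Qed.

Lemma measurable_marginalY (r : X * Y -> R) : measurable_fun setT r ->
  measurable_fun setT (marginalY mu r).
Proof.
move=> /measurable_EFinP mr; apply: (measurableT_comp (fine_measurable measurableT)).
rewrite (_ : (fun _ => _) = fun y =>
  \int[mu]_x (EFin \o r)^\+ (x, y) - \int[mu]_x (EFin \o r)^\- (x, y))%E.
  apply: emeasurable_funB.
    by apply: measurable_fun_fubini_tonelli_G => //; exact: measurable_funepos.
  by apply: measurable_fun_fubini_tonelli_G => //; exact: measurable_funeneg.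
by apply/funext => t; rewrite [LHS]integralE; congr (_ - _)%E;
  apply: eq_integral => u _; rewrite ?funeposE ?funenegE.
Qed.

Lemma integrable_marginalX (r : X * Y -> R) :
  (mu \x nu)%E.-integrable setT (EFin \o r) ->
  mu.-integrable setT (EFin \o marginalX nu r).
Proof.
move=> intr; have mr : measurable_fun setT r.
  by apply/measurable_EFinP; exact: measurable_int intr.
apply: le_integrable (integrable_fubini_F intr) => //.
  exact/measurable_EFinP/measurable_marginalX.
move=> x _; rewrite /fubini_F /= /marginalX /Rintegral.
by case: (integral _ _ _) => [a| |] /=; rewrite ?leey ?lexx.
Qed.

Lemma integrable_marginalY (r : X * Y -> R) :
  (mu \x nu)%E.-integrable setT (EFin \o r) ->
  nu.-integrable setT (EFin \o marginalY mu r).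
Proof.
move=> intr; have mr : measurable_fun setT r.
  by apply/measurable_EFinP; exact: measurable_int intr.
(* The absolute value of the partial integral is at most the partial integral of [|r|], and the
   latter has finite integral over [Y]. *)
have intG : nu.-integrable setT (fubini_G mu (EFin \o r)).
  apply/integrableP; split; first exact: measurable_fubini_G intr.
  have := (integrable21ltyP mu nu (measurable_int _ intr)).1 intr.
  apply: le_lt_trans; apply: ge0_le_integral => //.
  - by apply: measurableT_comp => //; exact: measurable_fubini_G intr.
  - apply: (measurable_fun_fubini_tonelli_G (abse \o (EFin \o r))) => //=.
    by apply: measurableT_comp => //; exact: measurable_int intr.
  - move=> y _; apply: le_abse_integral => //.
    by apply/measurable_EFinP; exact: measurableT_comp.
apply: le_integrable intG => //.
  exact/measurable_EFinP/measurable_marginalY.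
move=> x _; rewrite /fubini_G /= /marginalY /Rintegral.
by case: (integral _ _ _) => [a| |] /=; rewrite ?leey ?lexx.
Qed.

(** Fubini. The section of [r] at [x] is integrable only for almost every [x]; for these the
    marginal is a genuine integral and [f x] can be moved inside. *)
Lemma Rintegral_marginalX (r : X * Y -> R) (f : X -> R) :
  (mu \x nu)%E.-integrable setT (EFin \o r) -> bounded_measurable f ->
  (\int[mu]_x (marginalX nu r x * f x) = \int[(mu \x nu)%E]_z (r z * f z.1))%R.
Proof.
move=> intr bf.
have intrf : (mu \x nu)%E.-integrable setT (EFin \o (fun z => r z * f z.1)).
  apply: integrable_bounded_measurableM => //.
  case: bf => mf [B fB]; split; last by exists B => z.
  exact: measurableT_comp.
rewrite /Rintegral; congr fine.
rewrite -integral12_prod_meas1//; apply: ae_eq_integral => //.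
- apply/measurable_EFinP; apply: measurable_funM; last exact: bf.1.
  apply: measurable_marginalX.
  by apply/measurable_EFinP; exact: measurable_int intr.
- exact: measurable_fubini_F intrf.
apply: filterS (ae_integrable1 intr) => x intx _ /=.
rewrite /fubini_F /=; under eq_integral do rewrite EFinM.
rewrite integralZr//= EFinM; congr (_ * _)%E.
by rewrite /marginalX -EFin_Rintegral.
Qed.

Lemma Rintegral_marginalY (r : X * Y -> R) (f : Y -> R) :
  (mu \x nu)%E.-integrable setT (EFin \o r) -> bounded_measurable f ->
  (\int[nu]_y (marginalY mu r y * f y) = \int[(mu \x nu)%E]_z (r z * f z.2))%R.
Proof.
move=> intr bf.
have intrf : (mu \x nu)%E.-integrable setT (EFin \o (fun z => r z * f z.2)).
  apply: integrable_bounded_measurableM => //.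
  case: bf => mf [B fB]; split; last by exists B => z.
  exact: measurableT_comp.
rewrite /Rintegral; congr fine.
rewrite -integral21_prod_meas1//; apply: ae_eq_integral => //.
- apply/measurable_EFinP; apply: measurable_funM; last exact: bf.1.
  apply: measurable_marginalY.
  by apply/measurable_EFinP; exact: measurable_int intr.
- exact: measurable_fubini_G intrf.
apply: filterS (ae_integrable2 intr) => y inty _ /=.
rewrite /fubini_G /=; under eq_integral do rewrite EFinM.
rewrite integralZr//= EFinM; congr (_ * _)%E.
by rewrite /marginalY -EFin_Rintegral.
Qed.

End ProductSpace.

(** * Contraction in logarithmic variables *)

Section GeometricSequence.
Context {R : realType}.

(* [u n - D rho^n] increases and [u n + D rho^n] decreases. *)
Lemma geometric_increments_sup (u : nat -> R) (C rho : R) :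
  0 <= rho -> rho < 1 -> (forall n, `|u n.+1 - u n| <= C * rho ^+ n) ->
  let D := C / (1 - rho) in
  let l := sup (range (fun n => u n - D * rho ^+ n)) in
  forall n, `|u n - l| <= D * rho ^+ n.
Proof.
move=> rho0 rho1 uC D l n.
(* [D] sums the geometric series: [C * rho ^+ n] is the drop of [D * rho ^+ n] in one step, which
   gives both monotonicities. *)
have CE : C = D * (1 - rho) by rewrite divfK// gt_eqF// subr_gt0.
have lowS m : u m - D * rho ^+ m <= u m.+1 - D * rho ^+ m.+1.
  have := uC m; rewrite ler_norml => /andP[+ _].
  rewrite -subr_ge0 => h; rewrite -subr_ge0; apply: le_trans h _.
  by rewrite CE exprS le_eqVlt; apply/orP; left; apply/eqP; ring.
have uppS m : u m.+1 + D * rho ^+ m.+1 <= u m + D * rho ^+ m.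
  have := uC m; rewrite ler_norml => /andP[_].
  rewrite -subr_ge0 => h; rewrite -subr_ge0; apply: le_trans h _.
  by rewrite CE exprS le_eqVlt; apply/orP; left; apply/eqP; ring.
have C0 : 0 <= C.
  by have := le_trans (normr_ge0 _) (uC 0%N); rewrite expr0 mulr1.
have D0 : 0 <= D by rewrite divr_ge0// subr_ge0 ltW.
(* Both values are compared at the common index [maxn m m']. *)
have low_upp m m' : u m - D * rho ^+ m <= u m' + D * rho ^+ m'.
  have /nondecreasing_seqP low := lowS; have /nonincreasing_seqP upp := uppS.
  apply: (le_trans (low _ _ (leq_maxl m m'))).
  apply: le_trans (upp _ _ (leq_maxr m m')).
  by rewrite lerD2l (le_trans (y := 0)) ?oppr_le0// mulr_ge0 ?exprn_ge0.
have has_low : has_ubound (range (fun n => u n - D * rho ^+ n)).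
  by exists (u 0%N + D * rho ^+ 0) => _ [m _ <-].
rewrite ler_distlC; apply/andP; split.
  by apply: ub_le_sup => //; exists n.
by apply: ge_sup; [exists (u n - D * rho ^+ n), n|move=> _ [m _ <-]].
Qed.

End GeometricSequence.

(** * The half step on logarithms and its Lipschitz constant *)

Section LogStep.
Context d1 d2 (X : measurableType d1) (Y : measurableType d2) (R : realType).
Variable nu : probability Y R.
Variable K : X * Y -> R.
Variables k M : R.
Hypotheses (k_gt0 : 0 < k) (mK : measurable_fun setT K).
Hypothesis K_bnd : forall z, k <= K z <= M.
Variables (theta : R) (lp : X -> R).
Hypotheses (theta_ge0 : 0 <= theta) (blp : bounded_measurable lp).
Implicit Types beta : Y -> R.

(* [log_step] acts on [beta = log b] and returns [log a]. *)
Definition log_step beta : X -> R :=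
  fun x => theta * (lp x - ln (kernel_app nu K (expR \o beta) x)).

Let K_gt0 z : 0 < K z.
Proof. by have /andP[+ _] := K_bnd z; exact: lt_le_trans. Qed.

Let nu_fin : (nu setT < +oo)%E.
Proof. exact: probability_setT_lty. Qed.

Lemma integrable_kernel (b : Y -> R) x : bounded_measurable b ->
  nu.-integrable setT (EFin \o (fun y => K (x, y) * b y)).
Proof.
move=> bb; apply: bounded_measurable_integrable => //.
apply: bounded_measurableM => //; split.
  exact: measurableT_comp (pair1_measurable x).
exists M => y; rewrite gtr0_norm//.
by have /andP[] := K_bnd (x, y).
Qed.

Lemma measurable_kernel_app (b : Y -> R) : measurable_fun setT b ->
  measurable_fun setT (kernel_app nu K b).
Proof.
move=> mb; apply: (@measurable_marginalX _ _ _ _ _ nu (fun z => K z * b z.2)).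
by apply: measurable_funM => //; exact: measurableT_comp.
Qed.

Lemma kernel_app_le (b b' : Y -> R) x : bounded_measurable b ->
  bounded_measurable b' -> (forall y, b y <= b' y) ->
  kernel_app nu K b x <= kernel_app nu K b' x.
Proof.
move=> bb bb' h; apply: le_Rintegral => //; try exact: integrable_kernel.
by move=> y _ /=; rewrite ler_wpM2l// ltW.
Qed.

(** Constants integrate to themselves because [nu] is a probability. The lower bound [k] on the
    kernel keeps [kernel_app] away from 0, so its logarithm is bounded. *)
Lemma kernel_app_bounds (b : Y -> R) (l u : R) : bounded_measurable b ->
  0 < l -> (forall y, l <= b y <= u) ->
  forall x, k * l <= kernel_app nu K b x <= M * u.
Proof.
move=> bb l0 lbu x.
have cstE c : (\int[nu]_(y in setT) cst c y)%R = c.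
  by rewrite Rintegral_cst// [X in fine X](_ : _ = 1%E) ?mulr1//; exact: probability_setT.
have intc (c : R) : nu.-integrable setT (EFin \o cst c).
  by apply: bounded_measurable_integrable => //; exact: bounded_measurable_cst.
apply/andP; split.
  rewrite -[leLHS]cstE; apply: le_Rintegral => //; first exact: integrable_kernel.
  move=> y _ /=; have /andP[lb _] := lbu y; have /andP[kK _] := K_bnd (x, y).
  by apply: ler_pM => //; exact: ltW.
rewrite -[leRHS]cstE; apply: le_Rintegral => //; first exact: integrable_kernel.
move=> y _ /=; have /andP[lb bu] := lbu y; have /andP[_ KM] := K_bnd (x, y).
by apply: ler_pM => //; [exact: ltW|exact: le_trans (ltW l0) lb].
Qed.

Lemma kernel_app_expR_bounds beta : bounded_measurable beta ->
  exists l u : R, 0 < l /\ forall x, l <= kernel_app nu K (expR \o beta) x <= u.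
Proof.
move=> bbeta; have [mbeta [B betaB]] := bbeta.
exists (k * expR (- B)), (M * expR B); split; first by rewrite mulr_gt0 ?expR_gt0.
apply: kernel_app_bounds; [exact: bounded_measurable_expR|exact: expR_gt0|].
by move=> y; rewrite !ler_expR -ler_norml.
Qed.

Lemma kernel_app_expR_gt0 beta x : bounded_measurable beta ->
  0 < kernel_app nu K (expR \o beta) x.
Proof.
move=> /kernel_app_expR_bounds[l [u [l0 /(_ x)/andP[+ _]]]].
exact: lt_le_trans.
Qed.

Lemma bounded_measurable_ln_kernel_app beta : bounded_measurable beta ->
  bounded_measurable (fun x => ln (kernel_app nu K (expR \o beta) x)).
Proof.
move=> bbeta; have [l [u [l0 lu]]] := kernel_app_expR_bounds bbeta.
apply: (bounded_measurable_ln l0 _ lu).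
exact/measurable_kernel_app/(bounded_measurable_expR bbeta).1.
Qed.

Lemma bounded_measurable_log_step beta : bounded_measurable beta ->
  bounded_measurable (log_step beta).
Proof.
move=> bbeta; apply: bounded_measurableZ; apply: bounded_measurableB => //.
exact: bounded_measurable_ln_kernel_app.
Qed.

(** Adding [C] to [beta'] multiplies its image under the kernel by [expR C], by homogeneity;
    monotonicity of the kernel gives the rest. *)
Lemma ln_kernel_app_le beta beta' C x : bounded_measurable beta ->
  bounded_measurable beta' -> (forall y, beta y <= beta' y + C) ->
  ln (kernel_app nu K (expR \o beta) x) <=
  ln (kernel_app nu K (expR \o beta') x) + C.
Proof.
move=> bb bb' bbC; rewrite -[in leRHS](expRK C) -lnM ?posrE ?expR_gt0//; last first.
  exact: kernel_app_expR_gt0.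
have bexp := bounded_measurable_expR bb'.
rewrite ler_ln ?posrE ?mulr_gt0 ?expR_gt0//; try exact: kernel_app_expR_gt0.
rewrite mulrC /kernel_app -RintegralZl//; last exact: integrable_kernel.
rewrite [leRHS](_ : _ =
  kernel_app nu K (fun y => expR C * expR (beta' y)) x); last first.
  by apply: eq_Rintegral => y _ /=; rewrite mulrCA.
apply: kernel_app_le; [exact: bounded_measurable_expR|exact: bounded_measurableZ|].
by move=> y; rewrite -expRD ler_expR addrC.
Qed.

Lemma log_step_contract beta beta' C : bounded_measurable beta ->
  bounded_measurable beta' -> (forall y, `|beta y - beta' y| <= C) ->
  forall x, `|log_step beta x - log_step beta' x| <= theta * C.
Proof.
move=> bb bb' bbC x; rewrite /log_step -mulrBr normrM ger0_norm//.
rewrite ler_wpM2l// opprD opprK addrACA subrr add0r addrC ler_distl.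
have bbC' y : beta y <= beta' y + C /\ beta' y <= beta y + C.
  by have := bbC y; rewrite ler_distl lerBlDr => /andP[].
apply/andP; split; last by apply: ln_kernel_app_le => // y; have [] := bbC' y.
by rewrite lerBlDr; apply: ln_kernel_app_le => // y; have [] := bbC' y.
Qed.

End LogStep.

Lemma geometric_cvg (R : realType) (v : nat -> R) (l D rho : R) :
  0 <= rho -> rho < 1 -> (forall n, `|v n - l| <= D * rho ^+ n) ->
  v @ \oo --> l.
Proof.
move=> rho0 rho1 vD.
have Drho0 : geometric D rho @ \oo --> 0 by apply: cvg_geometric; rewrite ger0_norm.
apply/cvgrPdistC_le => e e0; near=> n.
rewrite (le_trans (vD n))// (le_trans (ler_norm _))//.
near: n; exact: (@cvgr0_norm_le _ _ _ \oo _ (geometric D rho) Drho0 _ e0).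
Unshelve. all: by end_near. Qed.

(** Banach's fixed point theorem for the sup norm, carried out at each point [t]. The limit is
    measurable as a pointwise limit, and bounded because it stays within [D] of [f0]. *)
Lemma bounded_measurable_fixpoint d (T : measurableType d) (R : realType)
    (Phi : (T -> R) -> T -> R) (rho : R) (f0 : T -> R) :
  0 <= rho -> rho < 1 ->
  (forall f, bounded_measurable f -> bounded_measurable (Phi f)) ->
  (forall f g C, bounded_measurable f -> bounded_measurable g ->
    (forall t, `|f t - g t| <= C) ->
    forall t, `|Phi f t - Phi g t| <= rho * C) ->
  bounded_measurable f0 ->
  exists2 f, bounded_measurable f /\ Phi f = f &
    exists D, forall n t, `|iter n Phi f0 t - f t| <= D * rho ^+ n.
Proof.
move=> rho0 rho1 bPhi cPhi bf0.
pose u n := iter n Phi f0.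
have bu n : bounded_measurable (u n) by elim: n => // n IHn; exact: bPhi.
have [C uC] : exists C, forall n t, `|u n.+1 t - u n t| <= C * rho ^+ n.
  have [_ [C hC]] := bounded_measurableB (bu 1%N) (bu 0%N).
  exists C; elim=> [t|n IHn t]; first by rewrite expr0 mulr1.
  rewrite exprS mulrCA; exact: (cPhi (u n.+1) (u n) _ (bu n.+1) (bu n) IHn).
have [D [f fD]] : exists D, exists f : T -> R,
    forall n t, `|u n t - f t| <= D * rho ^+ n.
  exists (C / (1 - rho)).
  exists (fun t => sup (range (fun n => u n t - C / (1 - rho) * rho ^+ n))).
  by move=> n t; exact: (geometric_increments_sup rho0 rho1 (uC^~ t)).
have uf t : u^~ t @ \oo --> f t := geometric_cvg rho0 rho1 (fD^~ t).
have bf : bounded_measurable f.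
  split.
    by apply: (@measurable_fun_cvg _ _ _ setT u) => // n; exact: (bu n).1.
  have [_ [B hB]] := bu 0%N; exists (B + D) => t.
  have := fD 0%N t; rewrite expr0 mulr1 distrC => h.
  by rewrite -[f t](subrK (u 0%N t)) addrC (le_trans (ler_normD _ _))// lerD.
exists f; last by exists D.
have ufS t : u n.+1 t @[n --> \oo] --> f t.
  by have := uf t; rewrite -(cvg_shiftS (u^~ t)).
(* The contraction estimate for [u n] and [f] gives a second limit of the shifted sequence; the two
   limits agree. *)
have uPhi t : u n.+1 t @[n --> \oo] --> Phi f t.
  apply: (geometric_cvg (D := rho * D) rho0 rho1) => n.
  by rewrite -mulrA; exact: (cPhi (u n) f _ (bu n) bf (fD n)).
split => //; apply/funext => t.
by rewrite -(cvg_lim _ (ufS t))// -(cvg_lim _ (uPhi t)).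
Qed.

(** * Optimality of the fixed point *)

Section KLTangent.
Context d (T : measurableType d) (R : realType).
Variable mu : {measure set T -> \bar R}.
Hypothesis mu_fin : (mu setT < +oo)%E.
Variables lv lw : T -> R.
Hypotheses (blv : bounded_measurable lv) (blw : bounded_measurable lw).

Let intb (f : T -> R) : bounded_measurable f -> mu.-integrable setT (EFin \o f).
Proof. exact: bounded_measurable_integrable. Qed.

Let integrable_tangent (u : T -> R) : mu.-integrable setT (EFin \o u) ->
  mu.-integrable setT
    (EFin \o (fun t => u t * (lw t - lv t) - expR (lw t) + expR (lv t))) /\
  (\int[mu]_t (u t * (lw t - lv t) - expR (lw t) + expR (lv t)))%R =
  (\int[mu]_t (u t * (lw t - lv t)))%R - (\int[mu]_t expR (lw t))%R +
  (\int[mu]_t expR (lv t))%R.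
Proof.
move=> intu.
have intud := integrable_bounded_measurableM intu (bounded_measurableB blw blv).
have intw := intb (bounded_measurable_expR blw).
have intv := intb (bounded_measurable_expR blv).
have intB := integrableB measurableT intud intw.
split; first exact: (integrableD measurableT intB intv).
by rewrite RintegralD// RintegralB.
Qed.

(** The integrated form of [kl_tangent], with the tangent taken at [expR \o lw]; only the first
    integral depends on [u]. *)
Lemma KL_tangent (u : T -> R) : mu.-integrable setT (EFin \o u) ->
  (((\int[mu]_t (u t * (lw t - lv t)))%R - (\int[mu]_t expR (lw t))%R +
    (\int[mu]_t expR (lv t))%R)%:E <= KL mu u (expR \o lv))%E.
Proof.
move=> intu; have [intt <-] := integrable_tangent intu.
rewrite -EFin_Rintegral//; apply: KL_ge => //.
- by apply/measurable_EFinP; exact: measurable_int intu.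
- exact: (bounded_measurable_expR blv).1.
- by apply: aeW => t; exact: expR_gt0.
- move=> t u0 _ /=; have := kl_tangent u0 (expR_gt0 (lv t)) (expR_gt0 (lw t)).
  by rewrite !expRK.
Qed.

(** The tangent is exact at its base point: this is the equality case [u = expR \o lw] of
    [KL_tangent]. *)
Lemma KL_expR : KL mu (expR \o lw) (expR \o lv) =
  ((\int[mu]_t (expR (lw t) * (lw t - lv t)))%R - (\int[mu]_t expR (lw t))%R +
    (\int[mu]_t expR (lv t))%R)%:E.
Proof.
have [intt <-] := integrable_tangent (intb (bounded_measurable_expR blw)).
rewrite -EFin_Rintegral// KLE; last 2 first.
- by move=> t; exact: expR_ge0.
- by move=> t; exact: expR_gt0.
by apply: eq_integral => t _ /=; rewrite klE ?expR_ge0 ?expR_gt0// !expRK mulrC.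
Qed.

End KLTangent.

Section Optimality.
Context d1 d2 (X : measurableType d1) (Y : measurableType d2) (R : realType).
Variables (mu : probability X R) (nu : probability Y R).
Variable K : X * Y -> R.
Variables k M : R.
Hypotheses (k_gt0 : 0 < k) (mK : measurable_fun setT K).
Hypothesis K_bnd : forall z, k <= K z <= M.
Variables (lp : X -> R) (lq : Y -> R).
Hypotheses (blp : bounded_measurable lp) (blq : bounded_measurable lq).
Variables (eps l1 l2 : R).
Hypotheses (eps_gt0 : 0 < eps) (l1_gt0 : 0 < l1) (l2_gt0 : 0 < l2).
Variables (alpha : X -> R) (beta : Y -> R).
Hypotheses (balpha : bounded_measurable alpha) (bbeta : bounded_measurable beta).

(** The half step on [Y] is the half step on [X] for the transposed kernel. *)
Let KT z := K (z.2, z.1).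

Hypothesis alphaE : alpha = log_step nu K (l1 / (l1 + eps)) lp beta.
Hypothesis betaE : beta = log_step mu KT (l2 / (l2 + eps)) lq alpha.

Let r z := expR (alpha z.1) * K z * expR (beta z.2).

Let mKT : measurable_fun setT KT.
Proof. by apply: (measurableT_comp mK); exact: measurable_swap. Qed.

Let KT_bnd z : k <= KT z <= M. Proof. exact: K_bnd. Qed.

Let prod_fin := product_measure_fin mu nu.

Let mu_fin : (mu setT < +oo)%E.
Proof. exact: probability_setT_lty. Qed.

Let nu_fin : (nu setT < +oo)%E.
Proof. exact: probability_setT_lty. Qed.

Let lK z := ln (K z).

Let KE : K = expR \o lK.
Proof.
apply/funext => z /=; rewrite lnK// posrE.
by have /andP[+ _] := K_bnd z; exact: lt_le_trans.
Qed.

Let blK : bounded_measurable lK.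
Proof. exact: (bounded_measurable_ln k_gt0 mK K_bnd). Qed.

Let lnKb x := ln (kernel_app nu K (expR \o beta) x).
Let lnKa y := ln (kernel_app mu KT (expR \o alpha) y).

Let blnKb : bounded_measurable lnKb.
Proof. exact: (bounded_measurable_ln_kernel_app _ k_gt0 mK K_bnd bbeta). Qed.

Let blnKa : bounded_measurable lnKa.
Proof. exact: (bounded_measurable_ln_kernel_app _ k_gt0 mKT KT_bnd balpha). Qed.

Let balpha1 : bounded_measurable (fun z : X * Y => alpha z.1).
Proof.
case: balpha => malpha [B hB]; split; first exact: measurableT_comp.
by exists B => z.
Qed.

Let bbeta2 : bounded_measurable (fun z : X * Y => beta z.2).
Proof.
case: bbeta => mbeta [B hB]; split; first exact: measurableT_comp.
by exists B => z.
Qed.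

Let lr z := alpha z.1 + lK z + beta z.2.

Let blr : bounded_measurable lr.
Proof. by do 2!apply: bounded_measurableD => //. Qed.

Let rE : r = expR \o lr.
Proof. by apply/funext => z; rewrite /r {1}KE /= !expRD. Qed.

Let marginalXE : marginalX nu r = expR \o (fun x => alpha x + lnKb x).
Proof.
apply/funext => x; rewrite /= expRD lnK; last first.
  by rewrite posrE; exact: (kernel_app_expR_gt0 _ k_gt0 mK K_bnd).
rewrite /kernel_app -RintegralZl//; last first.
  by apply: (integrable_kernel _ k_gt0 mK K_bnd); exact: bounded_measurable_expR.
by apply: eq_Rintegral => y _; rewrite /r/= mulrA.
Qed.

Let marginalYE : marginalY mu r = expR \o (fun y => beta y + lnKa y).
Proof.
apply/funext => y; rewrite /= expRD lnK; last first.
  by rewrite posrE; exact: (kernel_app_expR_gt0 _ k_gt0 mKT KT_bnd).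
rewrite /kernel_app -RintegralZl//; last first.
  by apply: (integrable_kernel _ k_gt0 mKT KT_bnd); exact: bounded_measurable_expR.
by apply: eq_Rintegral => x _; rewrite /r /KT/= mulrC [X in _ * X]mulrC.
Qed.

(** The fixed point equation rewritten as first-order optimality: the slope of the first entropy at
    the marginal of [r], namely [ln] of that marginal minus [lp], is proportional to [alpha]. *)
Let alpha_opt x : alpha x + lnKb x - lp x = - (eps / l1) * alpha x.
Proof.
have := congr1 (fun f => f x) alphaE; rewrite /= /log_step -/(lnKb x) => ->.
by field; rewrite !gt_eqF ?addr_gt0.
Qed.

Let beta_opt y : beta y + lnKa y - lq y = - (eps / l2) * beta y.
Proof.
have := congr1 (fun f => f y) betaE; rewrite /= /log_step -/(lnKa y) => ->.
by field; rewrite !gt_eqF ?addr_gt0.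
Qed.

(** [cX], [cY] and [cXY] are the parts of the three tangents that do not involve the competitor. *)
Let cX := - (\int[mu]_x expR (alpha x + lnKb x))%R + (\int[mu]_x expR (lp x))%R.
Let cY := - (\int[nu]_y expR (beta y + lnKa y))%R + (\int[nu]_y expR (lq y))%R.
Let cXY := - (\int[(mu \x nu)%E]_z expR (lr z))%R
  + (\int[(mu \x nu)%E]_z expR (lK z))%R.

Let A r' := (\int[(mu \x nu)%E]_z (r' z * alpha z.1))%R.
Let B r' := (\int[(mu \x nu)%E]_z (r' z * beta z.2))%R.

Section Terms.
Variable r' : X * Y -> R.
Hypothesis intr' : (mu \x nu)%E.-integrable setT (EFin \o r').

Let termX : (\int[mu]_x (marginalX nu r' x * (alpha x + lnKb x - lp x)))%R =
  - (eps / l1) * A r'.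
Proof.
rewrite (Rintegral_marginalX intr'); last first.
  by apply: bounded_measurableB => //; exact: bounded_measurableD.
rewrite /A -RintegralZl//; last exact: integrable_bounded_measurableM.
by apply: eq_Rintegral => z _; rewrite alpha_opt mulrCA.
Qed.

Let termY : (\int[nu]_y (marginalY mu r' y * (beta y + lnKa y - lq y)))%R =
  - (eps / l2) * B r'.
Proof.
rewrite (Rintegral_marginalY intr'); last first.
  by apply: bounded_measurableB => //; exact: bounded_measurableD.
rewrite /B -RintegralZl//; last exact: integrable_bounded_measurableM.
by apply: eq_Rintegral => z _; rewrite beta_opt mulrCA.
Qed.

Let termXY : (\int[(mu \x nu)%E]_z (r' z * (lr z - lK z)))%R = A r' + B r'.
Proof.
rewrite /A /B -RintegralD//; try exact: integrable_bounded_measurableM.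
by apply: eq_Rintegral => z _; rewrite /lr -mulrDr; congr (_ * _); ring.
Qed.

(** The pairings [A] and [B] of the competitor with [alpha] and [beta] cancel, because the marginal
    slopes carry the factors [- (eps / l1)] and [- (eps / l2)]. *)
Let sumE : l1 * (- (eps / l1) * A r' + cX) + l2 * (- (eps / l2) * B r' + cY)
  + eps * (A r' + B r' + cXY) = l1 * cX + l2 * cY + eps * cXY.
Proof. by field; rewrite !gt_eqF. Qed.

Lemma primal_ge : ((l1 * cX + l2 * cY + eps * cXY)%:E <=
  l1%:E * KL mu (marginalX nu r') (expR \o lp) +
  l2%:E * KL nu (marginalY mu r') (expR \o lq) +
  eps%:E * KL (mu \x nu)%E r' K)%E.
Proof.
rewrite -sumE 2!EFinD !EFinM {1}KE.
apply: leeD; [apply: leeD|]; rewrite lee_pmul2l ?lte_fin//.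
- rewrite -termX /cX addrA; apply: (KL_tangent mu_fin blp).
    exact: bounded_measurableD.
  exact: integrable_marginalX.
- rewrite -termY /cY addrA; apply: (KL_tangent nu_fin blq).
    exact: bounded_measurableD.
  exact: integrable_marginalY.
- by rewrite -termXY /cXY addrA; apply: (KL_tangent prod_fin blK).
Qed.

(** All three tangents are exact at [r]. Taking [r' = r] as a premise lets the identities for the
    section variable [r'] be reused. *)
Lemma primal_eq : r' = r ->
  (l1%:E * KL mu (marginalX nu r') (expR \o lp) +
  l2%:E * KL nu (marginalY mu r') (expR \o lq) +
  eps%:E * KL (mu \x nu)%E r' K)%E = (l1 * cX + l2 * cY + eps * cXY)%:E.
Proof.
move=> r'E; rewrite -sumE -termX -termY -termXY r'E marginalXE marginalYE.
rewrite {1}KE rE !KL_expR//; try exact: bounded_measurableD.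
by rewrite /cX /cY /cXY !addrA -!EFinM -!EFinD.
Qed.

End Terms.

Lemma scaling_fixpoint_optimal (F1 : (X -> R) -> \bar R) (F2 : (Y -> R) -> \bar R)
    (K0 : X * Y -> R) :
  (forall s, measurable_fun setT s -> F1 s = (l1%:E * KL mu s (expR \o lp))%E) ->
  (forall s, measurable_fun setT s -> F2 s = (l2%:E * KL nu s (expR \o lq))%E) ->
  measurable_fun setT K0 -> (\forall z \ae (mu \x nu)%E, K0 z = K z) ->
  scaling_solutions mu nu K0 F1 F2 eps r.
Proof.
move=> F1E F2E mK0 K0K.
have intr : (mu \x nu)%E.-integrable setT (EFin \o r).
  by rewrite rE; apply: bounded_measurable_integrable => //; exact: bounded_measurable_expR.
have JE r' : (mu \x nu)%E.-integrable setT (EFin \o r') ->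
    (F1 (marginalX nu r') + F2 (marginalY mu r') + eps%:E * KL (mu \x nu)%E r' K0)%E =
    (l1%:E * KL mu (marginalX nu r') (expR \o lp) +
     l2%:E * KL nu (marginalY mu r') (expR \o lq) +
     eps%:E * KL (mu \x nu)%E r' K)%E.
  move=> intr'; have mr' : measurable_fun setT r'.
    by apply/measurable_EFinP; exact: measurable_int intr'.
  rewrite F1E ?F2E ?(eq_KLr mr' mK0 mK)//; first exact: measurable_marginalY.
  exact: measurable_marginalX.
split; first exact/Lfun1_integrable.
move=> r' /Lfun1_integrable intr'.
(* The value at [r] is the very constant that bounds every competitor from below. *)
by rewrite JE// (primal_eq intr)// JE//; exact: primal_ge.
Qed.

End Optimality.

(** * From almost everywhere to pointwise bounds *)

Section EssentiallyBounded.
Context d (T : measurableType d) (R : realType).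
Variable mu : {measure set T -> \bar R}.
Implicit Types f : T -> R.

(** On a space of positive mass the norm of exponent [+oo] is the essential supremum of the absolute
    value. *)
Lemma Lfun_inftyP f : (0 < mu setT)%E ->
  f \in Lfun mu +oo%E <->
  measurable_fun setT f /\ exists M, \forall t \ae mu, `|f t| <= M.
Proof.
move=> mu0; rewrite inE/=; split.
- move=> /andP[]; rewrite !inE/= => mf; rewrite /finite_norm unlock mu0 => foo.
  by split => //; exact: ess_supr_bounded foo.
- move=> [mf [M fM]]; apply/andP; rewrite !inE/=; split => //.
  rewrite /finite_norm unlock mu0; apply: (@le_lt_trans _ _ M%:E); last exact: ltry.
  by apply/ess_supP.
Qed.

Lemma ae_clip f (l u : R) : l <= u -> measurable_fun setT f ->
  (\forall t \ae mu, l <= f t <= u) ->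
  exists g, [/\ measurable_fun setT g, forall t, l <= g t <= u &
    \forall t \ae mu, f t = g t].
Proof.
move=> lu mf flu; exists (fun t => Num.max l (Num.min (f t) u)); split.
- by apply: measurable_maxr => //; exact: measurable_minr.
- by move=> t; rewrite le_max lexx ge_max lu ge_min lexx orbT.
- apply: filterS flu => t /andP[lf fu].
  by rewrite min_l// max_r.
Qed.

Lemma log_LinftyP f : (0 < mu setT)%E -> log_Linfty mu f ->
  exists2 lf, bounded_measurable lf & \forall t \ae mu, f t = expR (lf t).
Proof.
move=> mu0 [mf f0 /Lfun_inftyP-/(_ mu0)[mlf [M lfM]]].
(* [ae_clip] asks for ordered end points; [|M|] guarantees this whatever the sign of [M]. *)
have [g [mg gM fg]] : exists g, [/\ measurable_fun setT g,
    forall t, - `|M| <= g t <= `|M| & \forall t \ae mu, ln (f t) = g t].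
  apply: ae_clip => //; first by rewrite ge0_cp.
  apply: filterS lfM => t h; rewrite -ler_norml (le_trans h)//; exact: ler_norm.
exists g; first by split => //; exists `|M| => t; rewrite ler_norml.
by apply: filterS2 f0 fg => t f0 <-; rewrite lnK.
Qed.

End EssentiallyBounded.

(** * Upper bounds for the Thompson metric *)

Section ThompsonMetric.
Context d (T : measurableType d) (R : realType).
Variable mu : {measure set T -> \bar R}.
Implicit Types r s : T -> R.

Lemma lne_Thompson_M_le r s (c : R) : (\forall t \ae mu, r t <= expR c * s t) ->
  (lne (Thompson_M mu r s) <= c%:E)%E.
Proof.
move=> rs; have -> : c%:E = lne (expR c)%:E by rewrite lne_EFin ?expR_gt0// expRK.
have M0 : (0 <= Thompson_M mu r s)%E.
  by apply/ereal_infP => _ /= [a [a0 _] <-]; rewrite lee_fin.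
rewrite lee_lne ?in_itv/= ?M0 ?leey ?lee_fin ?expR_ge0//.
(* [expR c] is one of the admissible ratios. *)
by apply: ereal_inf_lbound; exists (expR c) => //; split => //; exact: expR_ge0.
Qed.

Lemma Thompson_dist_le r s (c : R) :
  (\forall t \ae mu, r t <= expR c * s t /\ s t <= expR c * r t) ->
  (Thompson_dist mu r s <= c%:E)%E.
Proof.
move=> rs; rewrite /Thompson_dist ge_max !lne_Thompson_M_le//.
- by apply: filterS rs => t [].
- by apply: filterS rs => t [].
Qed.

End ThompsonMetric.

(** * Scaling iterates in logarithmic variables *)

Section ScalingStep.
Context d1 d2 (X : measurableType d1) (Y : measurableType d2) (R : realType).
Variables (mu : probability X R) (nu : probability Y R).

(** Dividing the geometric mean of [p] and [K b], with weights [theta] and [1 - theta], by [K b]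
    leaves [(p / K b)] to the power [theta]. [K0] is the given kernel and [K] its version with
    pointwise bounds; comparing them on sections suits both half steps. *)
Lemma scaling_step (K0 K : X * Y -> R) (k M : R) (F : (X -> R) -> \bar R)
    (l e : R) (lp : X -> R) (b beta : Y -> R) (s a : X -> R) :
  0 < k -> measurable_fun setT K -> (forall z, k <= K z <= M) ->
  measurable_fun setT K0 ->
  (\forall x \ae mu, \forall y \ae nu, K0 (x, y) = K (x, y)) ->
  0 < l -> 0 < e -> bounded_measurable lp ->
  (forall r, measurable_fun setT r -> F r = (l%:E * KL mu r (expR \o lp))%E) ->
  measurable_fun setT b -> bounded_measurable beta ->
  (\forall y \ae nu, b y = expR (beta y)) ->
  proxKL mu F e (kernel_app nu K0 b) s ->
  (\forall x \ae mu, a x = s x / kernel_app nu K0 b x) ->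
  \forall x \ae mu, a x = expR (log_step nu K (l / (l + e)) lp beta x).
Proof.
move=> k0 mK KkM mK0 K0K l0 e0 blp FE mb bbeta bE prox aE.
pose lz x := ln (kernel_app nu K (expR \o beta) x).
have zE : \forall x \ae mu, kernel_app nu K0 b x = expR (lz x).
  apply: filterS K0K => x K0Kx; rewrite /lz lnK; last first.
    by rewrite posrE; exact: (kernel_app_expR_gt0 _ k0 mK KkM).
  congr fine; apply: ae_eq_integral => //.
  - apply/measurable_EFinP; apply: measurable_funM => //.
    exact: measurableT_comp (pair1_measurable x).
  - exact: measurable_int (integrable_kernel nu k0 mK KkM x (bounded_measurable_expR bbeta)).
  - by apply: filterS2 K0Kx bE => y /= -> -> _.
have blz : bounded_measurable lz := bounded_measurable_ln_kernel_app nu k0 mK KkM bbeta.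
have := proxKL_KL (probability_setT_lty mu) l0 e0 blp blz FE
  (measurable_kernel_app nu mK0 mb) zE prox.
apply: filterS3 aE zE => x -> -> ->.
rewrite -expRN -expRD /log_step -/(lz x); congr expR; field.
by rewrite gt_eqF// addr_gt0.
Qed.

End ScalingStep.

Section ScaledKernel.
Context d1 d2 (X : measurableType d1) (Y : measurableType d2) (R : realType).
Implicit Types (K : X * Y -> R) (f : X -> R) (g : Y -> R).

Lemma bounded_measurable_scaled K f g : bounded_measurable K ->
  bounded_measurable f -> bounded_measurable g ->
  bounded_measurable (fun z => expR (f z.1) * K z * expR (g z.2)).
Proof.
move=> bK /bounded_measurable_expR[mf [B fB]] /bounded_measurable_expR[mg [C gC]].
apply: bounded_measurableM; [apply: bounded_measurableM => //|]; split.
- exact: (measurableT_comp mf measurable_fst).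
- by exists B => z; exact: fB.
- exact: (measurableT_comp mg measurable_snd).
- by exists C => z; exact: gC.
Qed.

End ScaledKernel.

Theorem theorem3p11 (R : realType) (d1 d2 : measure_display)
    (X : measurableType d1) (Y : measurableType d2)
    (mu : probability X R) (nu : probability Y R)
    (eps : R) (eps_gt0 : 0 < eps)
    (K : X * Y -> R) (K_Linfty : Linfty_nonneg (mu \x nu)%E K)
    (K_lbound : exists2 k : R, 0 < k & \forall z \ae (mu \x nu)%E, k <= K z)
    (p : X -> R) (q : Y -> R) (hp : log_Linfty mu p) (hq : log_Linfty nu q)
    (lambda1 lambda2 : R) (lambda1_gt0 : 0 < lambda1) (lambda2_gt0 : 0 < lambda2)
    (F1 : (X -> R) -> \bar R) (F2 : (Y -> R) -> \bar R)
    (F1E : forall s, F1 s = (lambda1%:E * KL mu s p)%E)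
    (F2E : forall s, F2 s = (lambda2%:E * KL nu s q)%E)
    (a : nat -> X -> R) (b : nat -> Y -> R)
    (ab_iter : scaling_iterates mu nu K F1 F2 eps a b) :
  exists2 r : X * Y -> R, scaling_solutions mu nu K F1 F2 eps r &
    Thompson_linear_cvg (mu \x nu)%E (fun l z => a l z.1 * K z * b l z.2) r.
Proof.
have mu_gt0 : (0 < mu setT)%E.
  by rewrite [ltRHS](_ : _ = 1%E) ?lte01//; exact: probability_setT.
have nu_gt0 : (0 < nu setT)%E.
  by rewrite [ltRHS](_ : _ = 1%E) ?lte01//; exact: probability_setT.
have munu_gt0 : (0 < (mu \x nu)%E setT)%E.
  by rewrite -setXTT product_measure1E// mule_gt0.
have [lp blp pE] := log_LinftyP mu_gt0 hp.
have [lq blq qE] := log_LinftyP nu_gt0 hq.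
have {}F1E s : measurable_fun setT s -> F1 s = (lambda1%:E * KL mu s (expR \o lp))%E.
  move=> ms; rewrite F1E (eq_KLr ms _ _ pE)//; first by case: hp.
  exact: (bounded_measurable_expR blp).1.
have {}F2E s : measurable_fun setT s -> F2 s = (lambda2%:E * KL nu s (expR \o lq))%E.
  move=> ms; rewrite F2E (eq_KLr ms _ _ qE)//; first by case: hq.
  exact: (bounded_measurable_expR blq).1.
have [k k0 kK] := K_lbound.
have [/(Lfun_inftyP _ munu_gt0)[mK [M KM]] K_ge0] := K_Linfty.
(* The upper end is [Num.max k M] so that the clipping interval is nonempty. *)
have [K' [mK' K'_bnd KK']] : exists K', [/\ measurable_fun setT K',
    forall z, k <= K' z <= Num.max k M & \forall z \ae (mu \x nu)%E, K z = K' z].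
  apply: ae_clip => //; first by rewrite le_max lexx.
  apply: filterS2 kK KM => z -> h /=; rewrite le_max (le_trans _ h) ?orbT//.
  exact: ler_norm.
have K'_gt0 z : 0 < K' z by have /andP[+ _] := K'_bnd z; exact: lt_le_trans.
have bK' : bounded_measurable K'.
  split=> //; exists (Num.max k M) => z; rewrite gtr0_norm//.
  by have /andP[] := K'_bnd z.
pose KT (z : Y * X) := K (z.2, z.1).
pose KT' (z : Y * X) := K' (z.2, z.1).
have mKT : measurable_fun setT KT.
  by apply: (measurableT_comp mK); exact: measurable_swap.
have mKT' : measurable_fun setT KT'.
  by apply: (measurableT_comp mK'); exact: measurable_swap.
have KT'_bnd z : k <= KT' z <= Num.max k M by exact: K'_bnd.
pose theta1 := lambda1 / (lambda1 + eps).
pose theta2 := lambda2 / (lambda2 + eps).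
have theta01 l : 0 < l -> 0 < l / (l + eps) < 1.
  by move=> l0; rewrite divr_gt0 ?addr_gt0//= ltr_pdivrMr ?addr_gt0//
    mul1r ltrDl.
have /andP[theta1_gt0 theta1_lt1] : 0 < theta1 < 1 by exact: theta01.
have /andP[theta2_gt0 theta2_lt1] : 0 < theta2 < 1 by exact: theta01.
pose stepX := log_step nu K' theta1 lp.
pose stepY := log_step mu KT' theta2 lq.
have bstepX f : bounded_measurable f -> bounded_measurable (stepX f).
  exact: (bounded_measurable_log_step nu k0 mK' K'_bnd).
have bstepY f : bounded_measurable f -> bounded_measurable (stepY f).
  exact: (bounded_measurable_log_step mu k0 mKT' KT'_bnd).
have cstepX := log_step_contract nu k0 mK' K'_bnd lp (ltW theta1_gt0).
have cstepY := log_step_contract mu k0 mKT' KT'_bnd lq (ltW theta2_gt0).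
(* A full round from [b] to the next [b] contracts by the product of the two half-step constants. *)
pose rho := theta2 * theta1.
have rho_gt0 : 0 < rho by rewrite mulr_gt0.
have rho_lt1 : rho < 1 by rewrite mulr_ilt1 ?ltW.
(* The iteration starts at 0, the logarithm of the initial value 1. *)
have [beta [bbeta betaE] [D betaD]] : exists2 beta,
    bounded_measurable beta /\ (stepY \o stepX) beta = beta &
    exists D, forall n y, `|iter n (stepY \o stepX) (fun=> 0) y - beta y| <= D * rho ^+ n.
  apply: bounded_measurable_fixpoint (ltW rho_gt0) rho_lt1 _ _ _.
  - by move=> f bf; exact/bstepY/bstepX.
  - move=> f g C bf bg fg y; rewrite /rho -mulrA.
    by apply: cstepY; [exact: bstepX|exact: bstepX|exact: cstepX].
  - exact: bounded_measurable_cst.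
set beta_ := fun n => iter n (stepY \o stepX) (fun=> 0) in betaD.
have bbeta_ n : bounded_measurable (beta_ n).
  elim: n => [|n IHn]; first exact: bounded_measurable_cst.
  exact/bstepY/bstepX.
have D_ge0 : 0 <= D.
  by have := le_trans (normr_ge0 _) (betaD 0%N point); rewrite expr0 mulr1.
pose alpha := stepX beta.
have alphaD n x : `|stepX (beta_ n) x - alpha x| <= theta1 * (D * rho ^+ n).
  exact: (cstepX (beta_ n) beta _ (bbeta_ n) bbeta (betaD n)).
have [[ma mb] b0 a_iter b_iter] := ab_iter.
have aS n : (\forall y \ae nu, b n y = expR (beta_ n y)) ->
    \forall x \ae mu, a n.+1 x = expR (stepX (beta_ n) x).
  move=> bE; have [s prox aE] := a_iter n.
  by apply: (scaling_step k0 mK' K'_bnd mK (ae_xsection KK') lambda1_gt0 eps_gt0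
    blp F1E (mb n) (bbeta_ n) bE prox aE).
(* By alternating half steps, the given iterates agree almost everywhere with the exponentials of
   the pointwise iteration. *)
have bE n : \forall y \ae nu, b n y = expR (beta_ n y).
  elim: n => [|n IHn]; first by apply: filterS b0 => y ->; rewrite expR0.
  have [s prox bE] := b_iter n.
  by apply: (scaling_step k0 mKT' KT'_bnd mKT (ae_ysection KK') lambda2_gt0 eps_gt0
    blq F2E (ma n) (bstepX _ (bbeta_ n)) (aS n IHn) prox bE).
have aE n := aS n (bE n).
(* Indices start at 1, since [a 0] is arbitrary; [a n.+1] is computed from [b n], so its logarithm
   is [stepX (beta_ n)]. *)
have uE n : \forall z \ae (mu \x nu)%E, a n.+1 z.1 * K z * b n.+1 z.2 =
    expR (stepX (beta_ n) z.1) * K' z * expR (beta_ n.+1 z.2).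
  by apply: filterS3 (ae_prod_fst nu (aE n)) KK' (ae_prod_snd mu (bE n.+1)) => z -> -> ->.
exists (fun z => expR (alpha z.1) * K' z * expR (beta z.2)).
  by apply: (scaling_fixpoint_optimal k0 mK' K'_bnd blp blq eps_gt0 lambda1_gt0
    lambda2_gt0 (bstepX _ bbeta) bbeta).
split.
- move=> [//|n] _; split.
    apply/Lfun_inftyP => //; split.
      apply: measurable_funM; [apply: measurable_funM => //|]; exact: measurableT_comp.
    have [_ [B hB]] := bounded_measurable_scaled bK' (bstepX _ (bbeta_ n)) (bbeta_ n.+1).
    by exists B; apply: filterS (uE n) => z ->.
  by apply: filterS (uE n) => z ->; rewrite !mulr_ge0 ?expR_ge0// ltW.
- split; last by apply: aeW => z; rewrite !mulr_ge0 ?expR_ge0// ltW.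
  have [mr [B hB]] := bounded_measurable_scaled bK' (bstepX _ bbeta) bbeta.
  apply/Lfun_inftyP => //; split; first exact: mr.
  by exists B; exact: aeW.
(* At index [n.+1] the error in [log a] is [theta1 * D * rho ^+ n], one power behind, hence the
   division by [rho]; the error in [log b] is [D * rho ^+ n.+1]. *)
exists (theta1 * D / rho + D), rho; split => //; [|exact: ltW|].
  by rewrite addr_ge0// divr_ge0 ?(ltW rho_gt0)// mulr_ge0 ?(ltW theta1_gt0).
move=> [//|n] _; pose c := theta1 * (D * rho ^+ n) + D * rho ^+ n.+1.
have -> : (theta1 * D / rho + D) * rho ^+ n.+1 = c.
  by rewrite /c exprS; field; rewrite gt_eqF.
apply: Thompson_dist_le; apply: filterS (uE n) => z ->.
(* The kernel is a common positive factor, so the comparison reduces to one of exponents. *)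
have scale x x' y y' : x + y <= c + (x' + y') ->
    expR x * K' z * expR y <= expR c * (expR x' * K' z * expR y').
  move=> xy; rewrite mulrAC -expRD [in leRHS]mulrAC -expRD mulrA -expRD.
  by rewrite ler_pM2r// ler_expR.
have := betaD n.+1 z.2; have := alphaD n z.1; rewrite !ler_distl => /andP[h1 h2] /andP[h3 h4].
split; apply: scale; rewrite /c.
- rewrite -[leRHS](_ : alpha z.1 + theta1 * (D * rho ^+ n) + (beta z.2 + D * rho ^+ n.+1) = _).
    exact: lerD.
  by ring.
- rewrite -lerBlDl; apply: le_trans (lerD h1 h3).
  by rewrite le_eqVlt; apply/orP; left; apply/eqP; ring.
Qed.
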